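(* Let $\mathfrak{g}$ be a complex simple Lie algebra of rank $r$ with root system $\Phi$, let $\widetilde{\mathfrak{g}}$ be the associated untwisted affine Lie algebra with affine root system $\widetilde\Phi$ and Chevalley involution $\widetilde\omega$, and let $\widetilde{\mathfrak{k}}_{\mathbb{Z}}$ be the integral form of the fix-point Lie subalgebra $\widetilde{\mathfrak{k}}$ of $\widetilde{\omega}$, with $\mathbb{Z}$-basis $\{y_\gamma^{(i)}\}_{\gamma\in\widetilde\Phi_+,\,1\le i\le m(\gamma)}$. The structure constants of $\widetilde{\mathfrak{k}}_{\mathbb{Z}}$ with respect to this $\mathbb{Z}$-basis are determined by: $$[y_{\alpha+\ell\delta},y_{\alpha+m\delta}]=\sum_{i=1}^rk_i(\alpha)\,y_{(m-\ell)\delta}^{(i)},\qquad [y_{\alpha+\ell\delta},y_{-\alpha+m\delta}]=\sum_{i=1}^rk_i(\alpha)\,y_{(m+\ell)\delta}^{(i)}$$ for $\alpha\in\Phi$ and $\ell,m\in\mathbb{Z}$; $$[y_{\alpha+\ell\delta},y_{\beta+m\delta}]=\kappa_{\alpha,\beta}\,y_{\alpha+\beta+(\ell+m)\delta}-\kappa_{\alpha,-\beta}\,y_{\alpha-\beta+(\ell-m)\delta}$$ for $\alpha,\beta\in\Phi$ with $\alpha\neq\pm\beta$ and $\ell,m\in\mathbb{Z}$; $$[y_{\ell\delta}^{(i)},y_{\alpha+m\delta}]=\alpha(h_i)\,y_{\alpha+(\ell+m)\delta}-\alpha(h_i)\,y_{\alpha+(m-\ell)\delta}$$ for $\alpha\in\Phi$,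 $\ell,m\in\mathbb{Z}$ and $1\le i\le r$; and $$[y_{\ell\delta}^{(i)},y_{m\delta}^{(j)}]=0$$ for $\ell,m\in\mathbb{Z}$ and $1\le i,j\le r$.
   Context: Finite data: fix a Cartan subalgebra $\mathfrak{h}\subset\mathfrak{g}$, positive roots $\Phi_+$, simple roots $\alpha_1,\ldots,\alpha_r$, highest root $\theta$. Let $(\cdot,\cdot)$ be the nondegenerate invariant symmetric bilinear form on $\mathfrak{g}$ normalized so that $(\alpha,\alpha)=2$ for long roots for the induced form on $\mathfrak{h}^*$. Let $t_\alpha\in\mathfrak{h}$ be defined by $(t_\alpha,h)=\alpha(h)$, $h_\alpha:=2t_\alpha/(\alpha,\alpha)$, $h_i:=h_{\alpha_i}$. Fix $e_i\in\mathfrak{g}_{\alpha_i}$, $f_i\in\mathfrak{g}_{-\alpha_i}$ with $[e_i,f_i]=h_i$, and let $\omega$ be the Chevalley involution of $\mathfrak{g}$: $\omega|_{\mathfrak{h}}=-\mathrm{Id}_{\mathfrak h}$, $\omega(e_i)=-f_i$. Choose $E_0\in\mathfrak{g}_{-\theta}$ with $(E_0,\omega(E_0))=-1$ and set $F_0:=-\omega(E_0)\in\mathfrak{g}_\theta$. Let $\{h_i,e_\alpha\}_{1\le i\le r,\alpha\in\Phi}$ be a Chevalley basis of $\mathfrak{g}$ with $e_\alpha\in\mathfrak{g}_\alpha$, $[e_\alpha,e_{-\alpha}]=h_\alpha$, $e_{\alpha_j}=e_j$, $e_{-\alpha_j}=f_j$, $e_\theta=F_0$, and $\omega(e_\alpha)=-e_{-\alpha}$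 for all $\alpha\in\Phi$. Define integers $\kappa_{\alpha,\beta}$ by $[e_\alpha,e_\beta]=\kappa_{\alpha,\beta}e_{\alpha+\beta}$ if $\alpha,\beta,\alpha+\beta\in\Phi$, and $\kappa_{\alpha,\beta}:=0$ if $\alpha+\beta\notin\Phi$ (terms with coefficient $\kappa=0$ for this reason are read as $0$). For $\alpha\in\Phi$ let $k_i(\alpha)\in\mathbb{Z}$ be such that $h_\alpha=\sum_{i=1}^rk_i(\alpha)h_i$. Affine data: $\widetilde{\mathfrak{g}}=(\mathfrak{g}\otimes\mathbb{C}[t,t^{-1}])\oplus\mathbb{C}c\oplus\mathbb{C}d$ with, writing $x[k]:=x\otimes t^k$, $[x[k],y[m]]=[x,y][k+m]+k\delta_{k,-m}(x,y)c$, $c$ central, $[d,x[m]]=m\,x[m]$. Let $\widetilde{\mathfrak{h}}=\mathfrak{h}\oplus\mathbb{C}c\oplus\mathbb{C}d$ and let $\delta\in\widetilde{\mathfrak{h}}^*$ be given by $\delta(d)=1$, $\delta(\mathfrak{h})=0=\delta(c)$; $\mathfrak{h}^*$ is identified with the functionals in $\widetilde{\mathfrak{h}}^*$ vanishing on $c,d$. The positive real affine roots are $\widetilde\Phi^{\mathrm{re}}_+=\Phi_+\cup\{\alpha+k\delta\mid\alpha\in\Phi,k\in\mathbb{Z}_{>0}\}$, the positive imaginary ones $\widetilde\Phi^{\mathrm{im}}_+=\mathbb{Z}_{>0}\delta$, and $\widetilde\Phi_+$ is their union, $\widetilde\Phi=\widetilde\Phi_+\cup(-\widetilde\Phi_+)$.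 The root multiplicities are $m(\gamma)=1$ for real $\gamma$ and $m(\gamma)=r$ for imaginary $\gamma$. The Chevalley involution satisfies $\widetilde\omega(x[k])=\omega(x)[-k]$, $\widetilde\omega(c)=-c$, $\widetilde\omega(d)=-d$, and $\widetilde{\mathfrak{k}}=\{x\in\widetilde{\mathfrak{g}}\mid\widetilde\omega(x)=x\}$. Let $\widetilde{\mathfrak{g}}_{\mathbb{Z}}$ be the $\mathbb{Z}$-span of $c$, $d$, $h_i[k]$, $e_\alpha[k]$ ($1\le i\le r$, $\alpha\in\Phi$, $k\in\mathbb{Z}$), and $\widetilde{\mathfrak{k}}_{\mathbb{Z}}:=\{x\in\widetilde{\mathfrak{g}}_{\mathbb{Z}}\mid\widetilde\omega(x)=x\}$. Its $\mathbb{Z}$-basis consists of $y_\gamma=y_\gamma^{(1)}:=e_\alpha[k]-e_{-\alpha}[-k]$ for $\gamma=\alpha+k\delta\in\widetilde\Phi^{\mathrm{re}}_+$ and $y_\gamma^{(i)}:=h_i[k]-h_i[-k]$ ($1\le i\le r$) for $\gamma=k\delta\in\widetilde\Phi^{\mathrm{im}}_+$. Conventions: $y_0^{(i)}:=0$ and $y_{-\gamma}^{(i)}:=-y_\gamma^{(i)}$ for $\gamma\in\widetilde\Phi_+$, $1\le i\le m(\gamma)$ (with $y_{-\gamma}:=-y_\gamma$ for real $\gamma$). *)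

(* Defs.v *)
From HB Require Import structures.
From mathcomp Require Import all_boot all_order all_algebra.
From mathcomp Require Import finmap monalg complex.
From mathcomp Require Import boolp classical_sets reals ring.

Set Implicit Arguments.
Unset Strict Implicit.
Unset Printing Implicit Defensive.
Import Order.TTheory GRing.Theory Num.Theory.

Local Open Scope ring_scope.

HB.mixin Record Lmodule_isLieAlgebra (K : fieldType) L of GRing.Lmodule K L := {
  bracket : L -> L -> L;
  bracket_linearl : forall y, linear (bracket^~ y);
  bracket_linearr : forall x, linear (bracket x);
  bracketxx : forall x, bracket x x = 0;
  bracket_jacobi : forall x y z,
    bracket x (bracket y z) + bracket y (bracket z x) + bracket z (bracket x y)
    = 0
}.

#[short(type="lieAlgType")]
HB.structure Definition LieAlgebra (K : fieldType) :=
  {L of GRing.Lmodule K L & Lmodule_isLieAlgebra K L}.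

#[short(type="finLieAlgType")]
HB.structure Definition FinLieAlgebra (K : fieldType) :=
  {L of Vector K L & Lmodule_isLieAlgebra K L}.

Notation "[ 'lie' x , y ]" := (bracket x y)
  (at level 0, format "[ 'lie'  x ,  y ]") : ring_scope.

Section BracketTheory.
Variables (K : fieldType) (L : lieAlgType K).
Implicit Types x y z : L.

Lemma bracketDl x y z : [lie x + y, z] = [lie x, z] + [lie y, z].
Proof. by have := bracket_linearl z 1 x y; rewrite !scale1r. Qed.

Lemma bracketDr x y z : [lie x, y + z] = [lie x, y] + [lie x, z].
Proof. by have := bracket_linearr x 1 y z; rewrite !scale1r. Qed.

Lemma bracket0l x : [lie 0, x] = 0.
Proof. by apply: (addIr [lie 0, x]); rewrite -bracketDl !add0r. Qed.

Lemma bracket0r x : [lie x, 0] = 0.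
Proof. by apply: (addIr [lie x, 0]); rewrite -bracketDr !add0r. Qed.

Lemma bracketZl a x y : [lie a *: x, y] = a *: [lie x, y].
Proof.
by have := bracket_linearl y a x 0; rewrite !addr0 bracket0l addr0.
Qed.

Lemma bracketZr a x y : [lie x, a *: y] = a *: [lie x, y].
Proof.
by have := bracket_linearr x a y 0; rewrite !addr0 bracket0r addr0.
Qed.

Lemma bracketC x y : [lie x, y] = - [lie y, x].
Proof.
apply/eqP; rewrite -addr_eq0; apply/eqP.
have := bracketxx (x + y).
by rewrite bracketDl !bracketDr !bracketxx add0r addr0.
Qed.

End BracketTheory.

Section FiniteDimensional.
Variables (K : fieldType) (g : finLieAlgType K).

Definition is_ideal (I : {vspace g}) : Prop :=
  forall x y : g, y \in I -> [lie x, y] \in I.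

Definition is_simple : Prop :=
  (exists x y : g, [lie x, y] != 0) /\
  (forall I : {vspace g}, is_ideal I -> I = 0%VS \/ I = fullv).

Definition bracketv (U V : {vspace g}) : {vspace g} :=
  <<[seq [lie u, v] | u <- vbasis U, v <- vbasis V]>>%VS.

Definition is_cartan (h : {vspace g}) : Prop :=
  [/\ (bracketv h h <= h)%VS,
      exists n, iter n (bracketv h) h = 0%VS
    & forall x : g, (forall y, y \in h -> [lie x, y] \in h) -> x \in h].

End FiniteDimensional.

Record invForm (K : fieldType) (L : lieAlgType K) := InvForm {
  form_fun :> L -> L -> K;
  form_linear : forall y, scalar (form_fun^~ y);
  form_sym : forall x y, form_fun x y = form_fun y x;
  form_inv : forall x y z, form_fun [lie x, y] z = form_fun x [lie y, z]
}.

Definition nondegenerate (K : fieldType) (L : lieAlgType K) (B : invForm L) :=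
  forall x, (forall y, B x y = 0) -> x = 0.

Notation hdual h := 'Hom(subvs_of h, (GRing.regular _)).

Section Roots.
Variables (K : fieldType) (g : finLieAlgType K) (h : {vspace g}).

Definition in_root_space (a : hdual h) (x : g) : Prop :=
  forall u : subvs_of h, [lie vsval u, x] = (a u : K) *: x.

Definition is_root (a : hdual h) : Prop :=
  a != 0 /\ exists2 x : g, x != 0 & in_root_space a x.

Definition in_nspan (r : nat) (s : 'I_r -> hdual h) (a : hdual h) : Prop :=
  exists n : 'I_r -> nat, a = \sum_i s i *+ n i.

Definition is_base (r : nat) (Phi : {fset hdual h}) (s : 'I_r -> hdual h) :
    Prop :=
  [/\ forall i, s i \in Phi,
      basis_of fullv [seq s i | i <- enum 'I_r]
    & forall a, a \in Phi -> in_nspan s a \/ in_nspan s (- a)].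

Variable B : invForm g.

(* the t_a with B t_a u = a u for all u in h; it exists and is unique when B   *)
(* is nondegenerate on h, in particular for nondegenerate invariant B on a     *)
(* simple Lie algebra with Cartan subalgebra h                                 *)
Definition tvec (a : hdual h) : subvs_of h :=
  xget 0 [set t | forall u : subvs_of h, B (vsval t) (vsval u) = a u].

Definition dual_form (a b : hdual h) : K := B (vsval (tvec a)) (vsval (tvec b)).

Definition coroot (a : hdual h) : subvs_of h := (2 / dual_form a a) *: tvec a.

End Roots.

(* An invariant form on a simple Lie algebra is a scalar multiple of the       *)
(* Killing form, and so is positive on the real span of the roots only up to   *)
(* a scalar; comparing moduli makes "long" independent of that scalar.         *)
Definition is_long (K : numFieldType) (g : finLieAlgType K) (h : {vspace g})
    (B : invForm g) (Phi : {fset hdual h}) (a : hdual h) : Prop :=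
  a \in Phi /\
  forall b, b \in Phi -> `|dual_form B b b| <= `|dual_form B a a|.

Record rootDatum (K : numFieldType) (g : finLieAlgType K) (r : nat) :=
  RootDatum {
    cartan : {vspace g};
    cartanP : is_cartan cartan;
    dim_cartan : \dim cartan = r;
    Phi : {fset hdual cartan};
    PhiP : forall a, a \in Phi <-> is_root a;
    simple_root : 'I_r -> hdual cartan;
    simple_rootP : is_base Phi simple_root;
    theta : hdual cartan;
    theta_root : theta \in Phi;
    theta_highest : forall a, a \in Phi -> in_nspan simple_root (theta - a);
    invform : invForm g;
    form_nondeg : nondegenerate invform;
    form_normalized : forall a, is_long invform Phi a ->
      dual_form invform a a = 2
  }.

Section RootDatumTheory.
Variables (K : numFieldType) (g : finLieAlgType K) (r : nat).
Variable D : rootDatum g r.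

Definition is_pos_root (a : hdual (cartan D)) : bool :=
  (a \in Phi D) && `[< in_nspan (simple_root D) a >].

Definition hroot (a : hdual (cartan D)) : subvs_of (cartan D) :=
  coroot (invform D) a.

Definition hsimple (i : 'I_r) : subvs_of (cartan D) := hroot (simple_root D i).

End RootDatumTheory.

Record chevalleyDatum (K : numFieldType) (g : finLieAlgType K) (r : nat)
    (D : rootDatum g r) := ChevalleyDatum {
  ei : 'I_r -> g;
  fi : 'I_r -> g;
  ei_root : forall i, in_root_space (simple_root D i) (ei i);
  fi_root : forall i, in_root_space (- simple_root D i) (fi i);
  bracket_ei_fi : forall i, [lie ei i, fi i] = vsval (hsimple D i);

  omega : 'End(g);
  omega_bracket : forall x y, omega [lie x, y] = [lie omega x, omega y];
  omega_invol : forall x, omega (omega x) = x;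
  omega_cartan : forall u : subvs_of (cartan D), omega (vsval u) = - vsval u;
  omega_ei : forall i, omega (ei i) = - fi i;

  E0 : g;
  F0 : g;
  E0_root : in_root_space (- theta D) E0;
  E0_norm : invform D E0 (omega E0) = - 1;
  F0_def : F0 = - omega E0;

  (* only the values of eroot, kappa and kcoef on the roots are meaningful *)
  eroot : hdual (cartan D) -> g;
  eroot_root : forall a, a \in Phi D -> in_root_space a (eroot a);
  chevalley_basis :
    basis_of fullv ([seq vsval (hsimple D i) | i <- enum 'I_r] ++
                    [seq eroot a | a <- enum_fset (Phi D)]);
  bracket_eroot : forall a, a \in Phi D ->
    [lie eroot a, eroot (- a)] = vsval (hroot a);
  eroot_simple : forall i, eroot (simple_root D i) = ei i;
  eroot_Nsimple : forall i, eroot (- simple_root D i) = fi i;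
  eroot_theta : eroot (theta D) = F0;
  omega_eroot : forall a, a \in Phi D -> omega (eroot a) = - eroot (- a);

  kappa : hdual (cartan D) -> hdual (cartan D) -> int;
  kappaP : forall a b,
    a \in Phi D -> b \in Phi D -> a + b \in Phi D ->
    [lie eroot a, eroot b] = eroot (a + b) *~ kappa a b;
  kappa0 : forall a b,
    a \in Phi D -> b \in Phi D -> a + b \notin Phi D -> kappa a b = 0;

  kcoef : hdual (cartan D) -> 'I_r -> int;
  kcoefP : forall a, a \in Phi D ->
    hroot a = \sum_i hsimple D i *~ kcoef a i
}.

(* L (x) K[t, t^-1], with << x *g k >> standing for x (x) t^k *)
Definition loop (K : fieldType) (L : lieAlgType K) := {malg L[int]}.

HB.instance Definition _ (K : fieldType) (L : lieAlgType K) :=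
  GRing.Zmodule.on (loop L).

Section Loop.
Variables (K : fieldType) (L : lieAlgType K) (B : invForm L).
Implicit Types (u v w : loop L) (a b : K).

Definition loop_scale a u : loop L := \sum_(k <- msupp u) << a *: u@_k *g k >>.

Lemma loop_scaleE a u k : (loop_scale a u)@_k = a *: u@_k.
Proof.
rewrite {2}[u]monalgE /loop_scale !raddf_sum /=.
by apply: eq_bigr => i _; rewrite !mcoeffU scalerMnr.
Qed.

Fact loop_scaleA a b u : loop_scale a (loop_scale b u) = loop_scale (a * b) u.
Proof. by apply/malgP => k; rewrite !loop_scaleE scalerA. Qed.

Fact loop_scale1 : left_id 1 loop_scale.
Proof. by move=> u; apply/malgP => k; rewrite loop_scaleE scale1r. Qed.

Fact loop_scaleDr : right_distributive loop_scale +%R.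
Proof.
move=> a u v; apply/malgP => k.
by rewrite mcoeffD !loop_scaleE mcoeffD scalerDr.
Qed.

Fact loop_scaleDl u : {morph loop_scale^~ u : a b / a + b}.
Proof.
by move=> a b; apply/malgP => k; rewrite mcoeffD !loop_scaleE scalerDl.
Qed.

HB.instance Definition _ := GRing.Zmodule_isLmodule.Build K (loop L)
  loop_scaleA loop_scale1 loop_scaleDr loop_scaleDl.

Definition loop_bracket u v : loop L :=
  \sum_(k <- msupp u) \sum_(m <- msupp v) << [lie u@_k, v@_m] *g k + m >>.

Definition loop_deriv u : loop L :=
  \sum_(k <- msupp u) << (k%:~R : K) *: u@_k *g k >>.

Definition loop_cocycle u v : K :=
  \sum_(k <- msupp u) k%:~R * B u@_k v@_(- k).

Lemma loopZU a x k : a *: (<< x *g k >> : loop L) = << a *: x *g k >>.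
Proof. by apply/malgP => m; rewrite loop_scaleE !mcoeffU scalerMnr. Qed.

Lemma loop_ind (P : loop L -> Prop) :
  (forall x k, P << x *g k >>) -> (forall u v, P u -> P v -> P (u + v)) ->
  forall u, P u.
Proof.
move=> PU PD u; rewrite [u]monalgE; apply: big_ind => //.
by rewrite -(@monalgU0 int L 0).
Qed.

Lemma sum_msuppD (W : zmodType) (F : int -> L -> W) u v :
    (forall k, {morph F k : x y / x + y}) ->
  \sum_(k <- msupp (u + v)) F k (u + v)@_k
  = \sum_(k <- msupp u) F k u@_k + \sum_(k <- msupp v) F k v@_k.
Proof.
move=> FD; have F0 k : F k 0 = 0.
  by apply: (addIr (F k 0)); rewrite -FD !add0r.
set T := (msupp u `|` msupp v)%fset.
have Fw (w : loop L) : (msupp w `<=` T)%fset ->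
    \sum_(k <- msupp w) F k w@_k = \sum_(k <- T) F k w@_k.
  move=> sub; apply/big_fset_incl => // k _ kw.
  by rewrite mcoeff_outdom.
rewrite !Fw ?fsubsetUl ?fsubsetUr ?msuppD_le // -big_split.
by apply: eq_bigr => k _; rewrite mcoeffD FD.
Qed.

Lemma sum_msuppU (W : zmodType) (F : int -> L -> W) x k :
    F k 0 = 0 ->
  \sum_(m <- msupp (<< x *g k >> : loop L)) F m (<< x *g k >> : loop L)@_m
  = F k x.
Proof.
move=> F0; rewrite msuppU; case: eqP => [->|_]; first by rewrite big_nil.
by rewrite big_seq_fset1 mcoeffUU.
Qed.

Lemma loop_bracketDl u v w :
  loop_bracket (u + v) w = loop_bracket u w + loop_bracket v w.
Proof.
pose F k x : loop L := \sum_(m <- msupp w) << [lie x, w@_m] *g k + m >>.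
apply: (@sum_msuppD _ F) => k x y; rewrite /F -big_split.
by apply: eq_bigr => m _; rewrite bracketDl monalgUD.
Qed.

Lemma loop_bracketDr u v w :
  loop_bracket u (v + w) = loop_bracket u v + loop_bracket u w.
Proof.
rewrite /loop_bracket -big_split; apply: eq_bigr => k _.
pose F m y : loop L := << [lie u@_k, y] *g k + m >>.
by apply: (@sum_msuppD _ F) => m x y; rewrite /F bracketDr monalgUD.
Qed.

Lemma loop_bracketUU x k y m :
  loop_bracket << x *g k >> << y *g m >> = << [lie x, y] *g k + m >>.
Proof.
pose F n z : loop L := \sum_(m' <- msupp (<< y *g m >> : loop L))
  << [lie z, (<< y *g m >> : loop L)@_m'] *g n + m' >>.
rewrite /loop_bracket (@sum_msuppU _ F) /F; last first.
  by rewrite big1 // => i _; rewrite bracket0l monalgU0.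
pose G n z : loop L := << [lie x, z] *g k + n >>.
by rewrite (@sum_msuppU _ G) // /G bracket0r monalgU0.
Qed.

Lemma loop_derivD u v : loop_deriv (u + v) = loop_deriv u + loop_deriv v.
Proof.
pose F k x : loop L := << (k%:~R : K) *: x *g k >>.
by apply: (@sum_msuppD _ F) => k x y; rewrite /F scalerDr monalgUD.
Qed.

Lemma loop_derivU x k :
  loop_deriv << x *g k >> = << (k%:~R : K) *: x *g k >>.
Proof.
pose F k x : loop L := << (k%:~R : K) *: x *g k >>.
by apply: (@sum_msuppU _ F); rewrite /F scaler0 monalgU0.
Qed.

Lemma formDl x y z : B (x + y) z = B x z + B y z.
Proof. by have := form_linear B z 1 x y; rewrite scale1r mul1r. Qed.

Lemma formDr x y z : B x (y + z) = B x y + B x z.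
Proof. by rewrite !(form_sym B x) formDl. Qed.

Lemma form0l z : B 0 z = 0.
Proof. by apply: (addIr (B 0 z)); rewrite -formDl !add0r. Qed.

Lemma formZl a x z : B (a *: x) z = a * B x z.
Proof. by have := form_linear B z a x 0; rewrite !addr0 form0l addr0. Qed.

Lemma formZr a x z : B z (a *: x) = a * B z x.
Proof. by rewrite !(form_sym B z) formZl. Qed.

Lemma loop_cocycleDl u v w :
  loop_cocycle (u + v) w = loop_cocycle u w + loop_cocycle v w.
Proof.
pose F (k : int) x : K := k%:~R * B x w@_(- k).
by apply: (@sum_msuppD _ F) => k x y; rewrite /F formDl mulrDr.
Qed.

Lemma loop_cocycleDr u v w :
  loop_cocycle u (v + w) = loop_cocycle u v + loop_cocycle u w.
Proof.
rewrite /loop_cocycle -big_split; apply: eq_bigr => k _.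
by rewrite mcoeffD formDr mulrDr.
Qed.

Lemma loop_cocycleUU x k y m :
  loop_cocycle << x *g k >> << y *g m >> = (k%:~R * B x y) *+ (k == - m).
Proof.
pose F (n : int) z : K := n%:~R * B z (<< y *g m >> : loop L)@_(- n).
rewrite /loop_cocycle (@sum_msuppU _ F) /F; last by rewrite form0l mulr0.
rewrite mcoeffU eq_sym eqr_oppLR; case: eqP => _; first by rewrite !mulr1n.
by rewrite !mulr0n form_sym form0l mulr0.
Qed.

Lemma loop_bracket0l u : loop_bracket 0 u = 0.
Proof. by rewrite /loop_bracket msupp0 big_nil. Qed.

Lemma loop_deriv0 : loop_deriv 0 = 0.
Proof. by rewrite /loop_deriv msupp0 big_nil. Qed.

Lemma loop_cocycle0l u : loop_cocycle 0 u = 0.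
Proof. by rewrite /loop_cocycle msupp0 big_nil. Qed.

Lemma loop_bracketZl a u v : loop_bracket (a *: u) v = a *: loop_bracket u v.
Proof.
elim/loop_ind: u => [x k|u1 u2 IH1 IH2]; last first.
  by rewrite scalerDr !loop_bracketDl IH1 IH2 scalerDr.
elim/loop_ind: v => [y m|v1 v2 IH1 IH2]; last first.
  by rewrite !loop_bracketDr IH1 IH2 scalerDr.
by rewrite loopZU !loop_bracketUU bracketZl loopZU.
Qed.

Lemma loop_bracketC u v : loop_bracket u v = - loop_bracket v u.
Proof.
elim/loop_ind: u => [x k|u1 u2 IH1 IH2]; last first.
  by rewrite loop_bracketDl loop_bracketDr IH1 IH2 opprD.
elim/loop_ind: v => [y m|v1 v2 IH1 IH2]; last first.
  by rewrite loop_bracketDl loop_bracketDr IH1 IH2 opprD.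
by rewrite !loop_bracketUU bracketC monalgUN addrC.
Qed.

Let addr3_eq0 (W : zmodType) (a1 a2 b1 b2 c1 c2 : W) :
  a1 + b1 + c1 = 0 -> a2 + b2 + c2 = 0 ->
  (a1 + a2) + (b1 + b2) + (c1 + c2) = 0.
Proof. by move=> H1 H2; rewrite (addrACA a1) (addrACA (a1 + b1)) H1 H2 addr0. Qed.

Lemma loop_jacobi u v w :
  loop_bracket u (loop_bracket v w) + loop_bracket v (loop_bracket w u)
    + loop_bracket w (loop_bracket u v) = 0.
Proof.
elim/loop_ind: u => [x k|u1 u2 IH1 IH2]; last first.
  rewrite !(loop_bracketDl, loop_bracketDr).
  exact: (@addr3_eq0 _ _ _ _ _ _ _ IH1 IH2).
elim/loop_ind: v => [y m|v1 v2 IH1 IH2]; last first.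
  rewrite !(loop_bracketDl, loop_bracketDr).
  exact: (@addr3_eq0 _ _ _ _ _ _ _ IH1 IH2).
elim/loop_ind: w => [z n|w1 w2 IH1 IH2]; last first.
  rewrite !(loop_bracketDl, loop_bracketDr).
  exact: (@addr3_eq0 _ _ _ _ _ _ _ IH1 IH2).
rewrite !loop_bracketUU.
have -> : m + (n + k) = k + (m + n) by ring.
have -> : n + (k + m) = k + (m + n) by ring.
by rewrite -!monalgUD bracket_jacobi monalgU0.
Qed.

Lemma loop_derivM u v : loop_deriv (loop_bracket u v)
  = loop_bracket (loop_deriv u) v + loop_bracket u (loop_deriv v).
Proof.
elim/loop_ind: u => [x k|u1 u2 IH1 IH2]; last first.
  rewrite (loop_derivD u1) (loop_bracketDl u1 u2 v) (loop_derivD (_ _ v)).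
  rewrite (loop_bracketDl _ _ v) (loop_bracketDl u1 u2 (_ v)) IH1 IH2.
  exact: (@addrACA (loop L)).
elim/loop_ind: v => [y m|v1 v2 IH1 IH2]; last first.
  rewrite (loop_derivD v1) (loop_bracketDr _ v1 v2) (loop_derivD (_ v1)).
  rewrite (loop_bracketDr _ v1 v2) (loop_bracketDr _ (_ v1)) IH1 IH2.
  exact: (@addrACA (loop L)).
rewrite !(loop_derivU, loop_bracketUU) bracketZl bracketZr -monalgUD.
by rewrite -scalerDl -intrD.
Qed.

Lemma loop_derivZ a u : loop_deriv (a *: u) = a *: loop_deriv u.
Proof.
elim/loop_ind: u => [x k|u1 u2 IH1 IH2]; last first.
  by rewrite scalerDr !loop_derivD IH1 IH2 scalerDr.
by rewrite !(loopZU, loop_derivU) !scalerA mulrC.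
Qed.

Lemma loop_cocycleZl a u v :
  loop_cocycle (a *: u) v = a * loop_cocycle u v.
Proof.
elim/loop_ind: u => [x k|u1 u2 IH1 IH2]; last first.
  by rewrite scalerDr !loop_cocycleDl IH1 IH2 mulrDr.
elim/loop_ind: v => [y m|v1 v2 IH1 IH2]; last first.
  by rewrite !loop_cocycleDr IH1 IH2 mulrDr.
by rewrite loopZU !loop_cocycleUU formZl mulrnAr mulrCA.
Qed.

Lemma loop_cocycleC u v : loop_cocycle u v = - loop_cocycle v u.
Proof.
elim/loop_ind: u => [x k|u1 u2 IH1 IH2]; last first.
  by rewrite loop_cocycleDl loop_cocycleDr IH1 IH2 opprD.
elim/loop_ind: v => [y m|v1 v2 IH1 IH2]; last first.
  by rewrite loop_cocycleDl loop_cocycleDr IH1 IH2 opprD.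
rewrite !loop_cocycleUU form_sym -eqr_oppLR eq_sym.
case: (m =P - k) => [->|_]; last by rewrite !mulr0n oppr0.
by rewrite !mulr1n rmorphN mulNr opprK.
Qed.

Lemma loop_cocycle_deriv u v :
  loop_cocycle u (loop_deriv v) = loop_cocycle v (loop_deriv u).
Proof.
elim/loop_ind: u => [x k|u1 u2 IH1 IH2]; last first.
  by rewrite loop_derivD loop_cocycleDl loop_cocycleDr IH1 IH2.
elim/loop_ind: v => [y m|v1 v2 IH1 IH2]; last first.
  by rewrite loop_derivD loop_cocycleDl loop_cocycleDr IH1 IH2.
rewrite !loop_derivU !loop_cocycleUU !formZr form_sym -eqr_oppLR eq_sym.
by case: eqP => // _; rewrite mulrCA.
Qed.

Lemma loop_cocycle_jacobi u v w :
  loop_cocycle u (loop_bracket v w) + loop_cocycle v (loop_bracket w u)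
    + loop_cocycle w (loop_bracket u v) = 0.
Proof.
elim/loop_ind: u => [x k|u1 u2 IH1 IH2]; last first.
  rewrite !(loop_bracketDl, loop_bracketDr, loop_cocycleDl, loop_cocycleDr).
  exact: (@addr3_eq0 _ _ _ _ _ _ _ IH1 IH2).
elim/loop_ind: v => [y m|v1 v2 IH1 IH2]; last first.
  rewrite !(loop_bracketDl, loop_bracketDr, loop_cocycleDl, loop_cocycleDr).
  exact: (@addr3_eq0 _ _ _ _ _ _ _ IH1 IH2).
elim/loop_ind: w => [z n|w1 w2 IH1 IH2]; last first.
  rewrite !(loop_bracketDl, loop_bracketDr, loop_cocycleDl, loop_cocycleDr).
  exact: (@addr3_eq0 _ _ _ _ _ _ _ IH1 IH2).
rewrite !loop_bracketUU !loop_cocycleUU -!addr_eq0.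
have -> : m + (n + k) = k + (m + n) by ring.
have -> : n + (k + m) = k + (m + n) by ring.
have -> : B y [lie z, x] = B x [lie y, z] by rewrite -form_inv form_sym.
have -> : B z [lie x, y] = B x [lie y, z] by rewrite form_sym form_inv.
case: eqP => [kmn0|_]; last by rewrite !mulr0n !addr0.
by rewrite !mulr1n -!mulrDl -!intrD -addrA kmn0 mul0r.
Qed.

End Loop.

(* (u, a, b) stands for u + a c + b d, where c is central and d acts by D *)
Section ExtensionBracket.
Variables (K : numFieldType) (W : lmodType K).
Variables (br : W -> W -> W) (D : W -> W) (psi : W -> W -> K).
Local Notation V := (W * GRing.regular K * GRing.regular K)%type.

Definition ext_bracket (X Y : V) : V :=
  let: (u, _, b) := X in let: (v, _, b') := Y in
  (br u v + (b : K) *: D v - (b' : K) *: D u, psi u v, 0).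

Hypothesis brD : forall u v w, br (u + v) w = br u w + br v w.
Hypothesis brZ : forall a u v, br (a *: u) v = a *: br u v.
Hypothesis brC : forall u v, br u v = - br v u.
Hypothesis brJ : forall u v w, br u (br v w) + br v (br w u) + br w (br u v) = 0.
Hypothesis DD : forall u v, D (u + v) = D u + D v.
Hypothesis DZ : forall a u, D (a *: u) = a *: D u.
Hypothesis DM : forall u v, D (br u v) = br (D u) v + br u (D v).
Hypothesis psiD : forall u v w, psi (u + v) w = psi u w + psi v w.
Hypothesis psiZ : forall a u v, psi (a *: u) v = a * psi u v.
Hypothesis psiC : forall u v, psi u v = - psi v u.
Hypothesis psiDer : forall u v, psi u (D v) = psi v (D u).
Hypothesis psiJ :
  forall u v w, psi u (br v w) + psi v (br w u) + psi w (br u v) = 0.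

Fact ext_bracket_linearl Y : linear (ext_bracket^~ Y).
Proof.
case: Y => [[w c] d] a [[u e] b] [[v e'] b'] /=.
congr (_, _, _); rewrite /= ?scaler0 ?addr0 ?psiD ?psiZ //.
rewrite brD brZ DD DZ !scalerDr scalerDl scalerN !scalerA opprD.
rewrite -[a *: b]/(a * b) (mulrC (d : K) a).
by rewrite [RHS]addrACA; congr (_ + _); rewrite addrACA.
Qed.

Fact ext_bracketC X Y : ext_bracket X Y = - ext_bracket Y X.
Proof.
case: X Y => [[u a] b] [[v a'] b'] /=; congr (_, _, _); rewrite /= ?oppr0 //.
by rewrite brC !opprD opprK addrAC.
Qed.

Fact ext_bracket_linearr X : linear (ext_bracket X).
Proof.
move=> a Y Z; rewrite ext_bracketC ext_bracket_linearl opprD -scalerN.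
by rewrite -!ext_bracketC.
Qed.

Fact ext_bracketxx X : ext_bracket X X = 0.
Proof.
have : ext_bracket X X + ext_bracket X X = 0.
  by rewrite {1}ext_bracketC addNr.
rewrite -mulr2n -scaler_nat => /eqP.
by rewrite scaler_eq0 pnatr_eq0 => /eqP.
Qed.

Fact ext_bracket_jacobi X Y Z :
  ext_bracket X (ext_bracket Y Z) + ext_bracket Y (ext_bracket Z X)
    + ext_bracket Z (ext_bracket X Y) = 0.
Proof.
case: X Y Z => [[u a] b] [[v a'] b'] [[w a''] b''] /=.
have brDr x y z : br x (y + z) = br x y + br x z.
  by rewrite brC brD opprD -!brC.
have brZr c x y : br x (c *: y) = c *: br x y.
  by rewrite brC brZ -scalerN -brC.
have brNr x y : br x (- y) = - br x y by rewrite -scaleN1r brZr scaleN1r.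
have DN x : D (- x) = - D x by rewrite -scaleN1r DZ scaleN1r.
have psiDr x y z : psi x (y + z) = psi x y + psi x z.
  by rewrite psiC psiD opprD -!psiC.
have psiZr c x y : psi x (c *: y) = c * psi x y.
  by rewrite psiC psiZ -mulrN -psiC.
have psiNr x y : psi x (- y) = - psi x y by rewrite -scaleN1r psiZr mulN1r.
congr (_, _, _); rewrite /= ?addr0 //; last first.
  rewrite !(psiDr, psiNr, psiZr) (psiDer u w) (psiDer v u) (psiDer w v).
  by rewrite -[RHS](psiJ u v w); ring.
rewrite ?scale0r ?subr0 !(brDr, brNr, brZr, DD, DN, DZ, DM).
rewrite !(brC (D _)) !(scalerDr, scalerN, scalerA, opprD, opprK).
rewrite (mulrC b' b) (mulrC b'' b) (mulrC b'' b').
pose t1 := b' *: br u (D w); pose t2 := b'' *: br u (D v).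
pose t3 := b *: br w (D v); pose t4 := b *: br v (D w).
pose t5 := (b * b') *: D (D w); pose t6 := (b * b'') *: D (D v).
pose t7 := b'' *: br v (D u); pose t8 := b' *: br w (D u).
pose t9 := (b' * b'') *: D (D u).
rewrite -/t1 -/t2 -/t3 -/t4 -/t5 -/t6 -/t7 -/t8 -/t9 !addrA.
rewrite -[RHS](brJ u v w).
by do 9![match goal with |- context [- ?t] =>
  rewrite !(addrAC _ t) ?(addrAC _ (- t)) addrK end].
Qed.
End ExtensionBracket.

Definition affine (K : numFieldType) (L : lieAlgType K) (B : invForm L) :
    Type :=
  (loop L * GRing.regular K * GRing.regular K)%type.

HB.instance Definition _ (K : numFieldType) (L : lieAlgType K)
  (B : invForm L) := GRing.Lmodule.on (affine B).

Section Affine.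
Variables (K : numFieldType) (L : lieAlgType K) (B : invForm L).

Definition affine_bracket : affine B -> affine B -> affine B :=
  ext_bracket (@loop_bracket K L) (@loop_deriv K L) (loop_cocycle B).

Fact affine_bracket_linearl Y : linear (affine_bracket^~ Y).
Proof.
exact: (ext_bracket_linearl (@loop_bracketDl _ _) (@loop_bracketZl _ _)
  (@loop_derivD _ _) (@loop_derivZ _ _) (@loop_cocycleDl _ _ B)
  (@loop_cocycleZl _ _ B)).
Qed.

Fact affine_bracket_linearr X : linear (affine_bracket X).
Proof.
exact: (ext_bracket_linearr (@loop_bracketDl _ _) (@loop_bracketZl _ _)
  (@loop_bracketC _ _) (@loop_derivD _ _) (@loop_derivZ _ _)
  (@loop_cocycleDl _ _ B) (@loop_cocycleZl _ _ B) (@loop_cocycleC _ _ B)).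
Qed.

Fact affine_bracketxx X : affine_bracket X X = 0.
Proof.
exact: (ext_bracketxx (@loop_deriv K L) (@loop_bracketC _ _) (@loop_cocycleC _ _ B)).
Qed.

Fact affine_bracket_jacobi X Y Z :
  affine_bracket X (affine_bracket Y Z) + affine_bracket Y (affine_bracket Z X)
    + affine_bracket Z (affine_bracket X Y) = 0.
Proof.
exact: (ext_bracket_jacobi (@loop_bracketDl _ _) (@loop_bracketZl _ _)
  (@loop_bracketC _ _) (@loop_jacobi _ _) (@loop_derivD _ _)
  (@loop_derivZ _ _) (@loop_derivM _ _) (@loop_cocycleDl _ _ B)
  (@loop_cocycleZl _ _ B) (@loop_cocycleC _ _ B)
  (@loop_cocycle_deriv _ _ B) (@loop_cocycle_jacobi _ _ B)).
Qed.

HB.instance Definition _ := Lmodule_isLieAlgebra.Build K (affine B)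
  affine_bracket_linearl affine_bracket_linearr affine_bracketxx
  affine_bracket_jacobi.

Definition tpow (x : L) (k : int) : affine B := (<< x *g k >> : loop L, 0, 0).
Definition affine_c : affine B := (0, 1, 0).
Definition affine_d : affine B := (0, 0, 1).

Lemma bracket_tpow x y k m : [lie tpow x k, tpow y m]
  = tpow [lie x, y] (k + m) + ((k%:~R * B x y) *+ (k == - m)) *: affine_c.
Proof.
rewrite /bracket /= /affine_bracket /ext_bracket /=.
rewrite !scale0r addr0 subr0 loop_bracketUU loop_cocycleUU.
congr (_, _, _); rewrite /= ?scaler0 ?addr0 ?add0r //.
by rewrite -[RHS]/(_ * 1) mulr1.
Qed.

Lemma bracket_affine_c X : [lie affine_c, X] = 0.
Proof.
case: X => [[u a] b]; rewrite /bracket /= /affine_bracket /ext_bracket /=.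
by rewrite loop_bracket0l loop_deriv0 loop_cocycle0l scale0r scaler0 addr0 subr0.
Qed.

Lemma bracket_affine_d x m : [lie affine_d, tpow x m] = m%:~R *: tpow x m.
Proof.
rewrite /bracket /= /affine_bracket /ext_bracket /=.
set u : loop L := << x *g m >>.
rewrite loop_bracket0l loop_cocycle0l scale1r scale0r add0r subr0 loop_derivU.
by congr (_, _, _); rewrite /= ?scaler0 ?loopZU.
Qed.

End Affine.

Definition zspan (V : zmodType) (S : V -> Prop) (x : V) : Prop :=
  exists2 s : seq (int * V),
    (forall p, p \in s -> S p.2) & x = \sum_(p <- s) p.2 *~ p.1.

(* {malg int[I]} is the group of finitely supported families of integers *)
Definition zbasis (I : choiceType) (V : zmodType) (P : V -> Prop) (y : I -> V) :
    Prop :=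
  forall x, P x <->
    exists! c : {malg int[I]}, x = \sum_(i <- msupp c) y i *~ c@_i.

Section IntegralForm.
Variables (K : numFieldType) (g : finLieAlgType K) (r : nat).
Variables (D : rootDatum g r) (Ch : chevalleyDatum D).

Local Notation gt := (affine (invform D)).

Definition affine_omega (X : gt) : gt :=
  let: (u, a, b) := X in
  (\sum_(k <- msupp u) << omega Ch u@_k *g - k >>, - a, - b).

Definition in_gtZ : gt -> Prop := zspan (fun X : gt =>
  [\/ X = affine_c _, X = affine_d _,
      exists i k, X = tpow _ (vsval (hsimple D i)) k
    | exists a k, a \in Phi D /\ X = tpow _ (eroot Ch a) k]).

Definition in_kt (X : gt) : Prop := affine_omega X = X.

Definition in_ktZ (X : gt) : Prop := in_gtZ X /\ in_kt X.

(* The pair (a, k) encodes a + k delta; elements of h^* + Z delta have a       *)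
(* unique such expression, and their sum and opposite are those of pairs.      *)
Definition aweight : Type := (hdual (cartan D) * int)%type.

HB.instance Definition _ := GRing.Zmodule.on aweight.

Definition is_pos_real (c : aweight) : bool :=
  (c.1 \in Phi D) && ((0 < c.2) || ((c.2 == 0) && is_pos_root c.1)).

Definition y_pos_real (c : aweight) : gt :=
  tpow _ (eroot Ch c.1) c.2 - tpow _ (eroot Ch (- c.1)) (- c.2).

(* y_gamma for a real root gamma; 0 outside the real roots *)
Definition y_real (c : aweight) : gt :=
  if is_pos_real c then y_pos_real c
  else if is_pos_real (- c) then - y_pos_real (- c)
  else 0.

Definition y_pos_imag (i : 'I_r) (k : int) : gt :=
  tpow _ (vsval (hsimple D i)) k - tpow _ (vsval (hsimple D i)) (- k).

Definition y_imag (i : 'I_r) (k : int) : gt :=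
  if 0 < k then y_pos_imag i k
  else if 0 < - k then - y_pos_imag i (- k)
  else 0.

(* the indices (gamma, i), gamma a positive affine root and 1 <= i <= m(gamma) *)
Definition y_index : Type :=
  ({c : aweight | is_pos_real c} + {k : int | 0 < k} * 'I_r)%type.

HB.instance Definition _ := Choice.on y_index.

Definition y_family (j : y_index) : gt :=
  match j with
  | inl c => y_real (val c)
  | inr (k, i) => y_imag i (val k)
  end.

End IntegralForm.

(* Main.v *)
Require Import Defs.
From HB Require Import structures.
From mathcomp Require Import all_boot all_order all_algebra.
From mathcomp Require Import finmap monalg complex.
From mathcomp Require Import boolp reals.
Import Order.TTheory GRing.Theory Num.Theory.
Local Open Scope ring_scope.

(* Write Y(x, k) := x[k] + omega(x)[-k].  Every basis element is of this form:
   y_{a + k delta} = Y(e_a, k) for every root a and integer k, and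
   y_{k delta}^{(i)} = Y(h_i, k) for every k.  Since the form is omega-invariant,
   the central terms cancel in
     [Y(x, k), Y(y, m)] = Y([x, y], k + m) + Y([x, omega y], k - m),
   and all the structure constants are instances of this identity, together with
   Y(omega x, k) = Y(x, -k).

   For the basis property, let phi_j be the coordinate of e_a[k] (resp. h_i[k])
   for j = a + k delta (resp. j = (k delta, i)) positive.  The phi_j are integral
   on the integral form and dual to the y_j; an omega-fixed element x killed by
   all of them is 0, because omega exchanges, up to sign, the coordinates at
   opposite roots.  Hence x = sum_j phi_j(x) y_j. *)

(** * Coordinates with respect to a basis given as a sequence *)

Section BasisCoefficients.
Set Implicit Arguments.
Unset Strict Implicit.
Variables (K : fieldType) (V : vectType K) (X : seq V).
Implicit Types (v w x : V).

Lemma span_ind (P : V -> Prop) :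
    P 0 -> (forall a x y, P x -> P y -> P (a *: x + y)) ->
    (forall v, v \in X -> P v) ->
  forall x, x \in <<X>>%VS -> P x.
Proof.
move=> P0 PD PX x /(@coord_span _ _ _ (in_tuple X)) ->.
elim/big_rec: _ => // i y _ Py; apply: PD => //.
by apply: PX; rewrite mem_nth.
Qed.

(** The coordinate is indexed by the basis vector instead of its position, so that coordinates at
    [e a] and [hs i] can be named without their rank in the sequence. When [X] is free the sum has
    at most one term. *)
Definition bcoef v x : K :=
  \sum_(i < size X | X`_i == v) coord (in_tuple X) i x.

Lemma bcoef_linear v : scalar (bcoef v).
Proof.
move=> a x y; rewrite /bcoef mulr_sumr -big_split.
by apply: eq_bigr => i _; rewrite linearP.
Qed.

HB.instance Definition _ v :=
  GRing.isLinear.Build K V K *%R (bcoef v) (bcoef_linear v).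

Hypothesis X_basis : basis_of fullv X.

Lemma bcoef_mem v w : w \in X -> bcoef v w = (v == w)%:R.
Proof.
move=> /(nthP 0)[j jX <-]; pose j' := Ordinal jX.
rewrite /bcoef big_mkcond (bigD1 j') //= big1 => [|i i_neq_j].
  rewrite addr0 eq_sym (@coord_free _ _ _ (in_tuple X) j' j') ?eqxx.
    by case: eqP.
  exact: basis_free X_basis.
rewrite (@coord_free _ _ _ (in_tuple X) j' i) ?(basis_free X_basis) //.
by rewrite (eq_sym j') (negbTE i_neq_j) if_same.
Qed.

Lemma bcoef_eq0 x : (forall v, v \in X -> bcoef v x = 0) -> x = 0.
Proof.
move=> x0; rewrite (@coord_basis _ _ _ _ (in_tuple X) x X_basis (memvf x)).
rewrite big1 // => i _; rewrite -(_ : bcoef X`_i x = coord (in_tuple X) i x).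
  by rewrite x0 ?scale0r ?mem_nth.
rewrite /bcoef (big_pred1 i) // => j.
by rewrite /= nth_uniq // (free_uniq (basis_free X_basis)).
Qed.

End BasisCoefficients.

(** * Closure properties of integral spans *)

Section IntegralSpan.
Set Implicit Arguments.
Unset Strict Implicit.
Variables (V : zmodType) (S : V -> Prop).

Lemma zspan_gen v : S v -> zspan S v.
Proof.
move=> Sv; exists [:: (1, v)]; last by rewrite big_seq1.
by move=> p; rewrite inE => /eqP ->.
Qed.

Lemma zspan0 : zspan S 0.
Proof. by exists [::]; rewrite ?big_nil. Qed.

(** This shape is the inductive step for sums of integral multiples, and [n = -1] gives
    differences. *)
Lemma zspan_comb v w n :
  zspan S v -> zspan S w -> zspan S (v *~ n + w).
Proof.
move=> [s sS ->] [t tS ->].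
exists ([seq (n * p.1, p.2) | p <- s] ++ t).
  by move=> p; rewrite mem_cat => /orP[/mapP[q qs ->]|/tS //]; apply: (sS q).
rewrite big_cat big_map /=; congr (_ + _).
rewrite (big_morph (fun x : V => x *~ n) (id1 := 0) (op1 := +%R)) ?mul0rz //.
  by apply: eq_bigr => p _; rewrite mulrC mulrzA.
by move=> x y; rewrite mulrzDl.
Qed.

End IntegralSpan.

Section ChevalleyDatum.
Set Implicit Arguments.
Unset Strict Implicit.
Variables (K : numFieldType) (g : finLieAlgType K) (r : nat).
Variables (D : rootDatum g r) (Ch : chevalleyDatum D).

Local Notation h := (cartan D).
Local Notation B := (invform D).
Local Notation hs i := (vsval (hsimple D i)).
Local Notation e := (eroot Ch).
Local Notation om := (omega Ch).
Implicit Types (a b : hdual h) (u v : subvs_of h) (x y z : g) (k l m : int).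

(** * The Chevalley basis of [g] *)

Definition chevalley_seq : seq g :=
  [seq hs i | i <- enum 'I_r] ++ [seq e a | a <- enum_fset (Phi D)].

Lemma hsimple_chevalley i : hs i \in chevalley_seq.
Proof. by rewrite mem_cat (map_f (fun i => hs i)) ?mem_enum. Qed.

Lemma eroot_chevalley a : a \in Phi D -> e a \in chevalley_seq.
Proof. by move=> aP; rewrite mem_cat map_f ?orbT. Qed.

Lemma chevalley_seqP x : x \in chevalley_seq ->
  (exists i, x = hs i) \/ (exists2 a, a \in Phi D & x = e a).
Proof.
rewrite mem_cat => /orP[/mapP[i _ ->]|/mapP[a aP ->]]; first by left; exists i.
by right; exists a.
Qed.

Lemma chevalley_uniq : uniq chevalley_seq.
Proof. exact: free_uniq (basis_free (chevalley_basis Ch)). Qed.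

Lemma eroot_neq0 a : a \in Phi D -> e a != 0.
Proof.
move/eroot_chevalley; apply: free_not0.
exact: basis_free (chevalley_basis Ch).
Qed.

Lemma hsimple_inj : injective (fun i => hs i).
Proof.
have := chevalley_uniq; rewrite cat_uniq => /andP[U _].
exact/injectiveP.
Qed.

Lemma chevalley_ind (P : g -> Prop) :
    P 0 -> (forall c x y, P x -> P y -> P (c *: x + y)) ->
    (forall i, P (hs i)) -> (forall a, a \in Phi D -> P (e a)) ->
  forall x, P x.
Proof.
move=> P0 PD Ph Pe x.
apply: (@span_ind _ _ chevalley_seq P P0 PD).
  by move=> v /chevalley_seqP[[i ->]|[a aP ->]]; [apply: Ph|apply: Pe].
by rewrite (span_basis (chevalley_basis Ch)) memvf.
Qed.

(** * Root spaces, the involution and brackets of root vectors *)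

Lemma bracketv_mem (U W : {vspace g}) x y :
  x \in U -> y \in W -> [lie x, y] \in bracketv U W.
Proof.
rewrite -{1}(span_basis (vbasisP U)) -{1}(span_basis (vbasisP W)) => xU yW.
apply: (@span_ind _ _ (vbasis U) (fun x => [lie x, y] \in _)) xU
  => {x}[|c x1 x2 IH1 IH2|x xU].
- by rewrite bracket0l mem0v.
- by rewrite bracketDl bracketZl memvD ?memvZ.
apply: (@span_ind _ _ (vbasis W) (fun y => [lie x, y] \in _)) yW
  => {y}[|c y1 y2 IH1 IH2|y yW].
- by rewrite bracket0r mem0v.
- by rewrite bracketDr bracketZr memvD ?memvZ.
exact/memv_span/allpairs_f.
Qed.

Lemma addrr_eq0 (V : lmodType K) (x : V) : x + x = 0 -> x = 0.
Proof.
by rewrite -mulr2n -scaler_nat => /eqP; rewrite scaler_eq0 pnatr_eq0 => /eqP.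
Qed.

(* The Chevalley involution is -1 on h, hence both 1 and -1 on [h, h]. *)
Lemma bracket_cartan u v : [lie vsval u, vsval v] = 0.
Proof.
have [hh _ _] := cartanP D.
have /vsprojK uvE : [lie vsval u, vsval v] \in h.
  by apply: subvP hh _ _; apply: bracketv_mem; apply: subvsP.
apply: addrr_eq0; rewrite -[X in X + _]opprK -{1}uvE -(omega_cartan Ch) uvE.
rewrite omega_bracket !omega_cartan -!scaleN1r bracketZl bracketZr.
by rewrite scalerA mulrNN mul1r scale1r scaleN1r addNr.
Qed.

Lemma omega_root_space a x : in_root_space a x -> in_root_space (- a) (om x).
Proof.
move=> ax u; rewrite -[vsval u]opprK -(omega_cartan Ch) -scaleN1r bracketZl.
by rewrite -omega_bracket ax linearZ /= opp_lfunE scaleN1r scaleNr.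
Qed.

Lemma root_neq0 a : a \in Phi D -> a != 0.
Proof. by move=> /PhiP[]. Qed.

(** The involution is injective and negates weights, so [om (e a)] is a nonzero vector of weight
    [- a]. *)
Lemma oppr_Phi a : a \in Phi D -> - a \in Phi D.
Proof.
move=> aP; apply/PhiP; split; first by rewrite oppr_eq0 root_neq0.
exists (om (e a)); last exact/omega_root_space/eroot_root.
apply: contra_neq (eroot_neq0 aP) => z.
by rewrite -(omega_invol Ch (e a)) z linear0.
Qed.

Lemma bracket_root_space a b x y : in_root_space a x -> in_root_space b y ->
  in_root_space (a + b) [lie x, y].
Proof.
move=> ax bY u; have /eqP := bracket_jacobi (vsval u) x y.
rewrite (bracketC y (vsval u)) ax bY -scaleNr !bracketZr (bracketC y x).
rewrite -addrA addr_eq0 => /eqP ->.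
by rewrite scalerN scaleNr -opprD opprK add_lfunE scalerDl addrC.
Qed.

(** If [a + b] is not a root, both sides vanish: a nonzero bracket would have the nonzero weight
    [a + b] and so make it a root. *)
Lemma bracket_eroots a b : a \in Phi D -> b \in Phi D -> a + b != 0 ->
  [lie e a, e b] = e (a + b) *~ kappa Ch a b.
Proof.
move=> aP bP ab0; case: (boolP (a + b \in Phi D)) => [abP|abNP].
  exact: kappaP.
rewrite (kappa0 Ch aP bP) // mulr0z; apply: contraNeq abNP => ne0.
apply/PhiP; split=> //; exists [lie e a, e b] => //.
by apply: bracket_root_space; apply: eroot_root.
Qed.

(** * The invariant form on weight spaces *)

Lemma lfun_neq0P a : a != 0 -> exists u, (a u : K) != 0.
Proof.
move=> a0; apply: contrapT => N; case/eqP: a0; apply/lfunP => u.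
rewrite zero_lfunE; apply/eqP; apply: contrapT => /negP ne; apply: N.
by exists u.
Qed.

(** Moving [u] in the Cartan subalgebra across the form by invariance gives
    [(a + b)(u) * B x y = 0]; choose [u] with [(a + b)(u) != 0]. *)
Lemma form_root_space a b x y : in_root_space a x -> in_root_space b y ->
  a + b != 0 -> B x y = 0.
Proof.
move=> ax bY /lfun_neq0P[u]; rewrite add_lfunE => ne.
have : ((a u : K) + b u) * B x y = 0.
  rewrite mulrDl -Defs.formZl -ax -Defs.formZr -bY -form_inv (bracketC x).
  by rewrite -scaleN1r Defs.formZl mulN1r subrr.
by move/eqP; rewrite mulf_eq0 (negbTE ne) => /eqP.
Qed.

(** The Cartan subalgebra has weight 0, so [form_root_space] also covers its orthogonality to root
    vectors. *)
Lemma cartan_root_space u : in_root_space (0 : hdual h) (vsval u).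
Proof. by move=> v; rewrite bracket_cartan zero_lfunE scale0r. Qed.

Lemma formNN x y : B (- x) (- y) = B x y.
Proof. by rewrite -!scaleN1r Defs.formZl Defs.formZr !mulN1r opprK. Qed.

Lemma form_cartan_eroot u a : a \in Phi D -> B (vsval u) (e a) = 0.
Proof.
move=> aP; apply: form_root_space (cartan_root_space _) (eroot_root Ch aP) _.
by rewrite add0r root_neq0.
Qed.

(** By bilinearity, pairs of Chevalley basis vectors suffice. The two signs cancel; pairs whose
    weights are not opposite are orthogonal before and after [om], and the pair [e a], [e (- a)] is
    merely swapped, which symmetry of the form absorbs. *)
Lemma form_omega x y : B (om x) (om y) = B x y.
Proof.
elim/chevalley_ind: x => [|c x1 x2 IH1 IH2|i|a aP];
  [by rewrite linear0 !Defs.form0l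
  |by rewrite linearP !Defs.formDl !Defs.formZl IH1 IH2| |];
elim/chevalley_ind: y => [|c y1 y2 IH1 IH2|j|b bP];
  try by [rewrite linear0 !(form_sym _ _ 0) !Defs.form0l
         |rewrite linearP !Defs.formDr !Defs.formZr IH1 IH2].
- by rewrite !omega_cartan formNN.
- rewrite omega_cartan omega_eroot // formNN.
  by rewrite !form_cartan_eroot ?oppr_Phi.
- rewrite omega_cartan omega_eroot // formNN !(form_sym _ _ (hs j)).
  by rewrite !form_cartan_eroot ?oppr_Phi.
rewrite !omega_eroot // formNN.
have [->|ab0] := eqVneq b (- a); first by rewrite opprK form_sym.
have aNb : a + b != 0 by rewrite addrC addr_eq0.
rewrite (form_root_space (eroot_root Ch aP) (eroot_root Ch bP)) //.
apply: form_root_space (eroot_root Ch (oppr_Phi aP)) _ _.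
  exact: eroot_root (oppr_Phi bP).
by rewrite -opprD oppr_eq0.
Qed.

(** * The fixed vectors Y(x, k) in the affine algebra and their brackets *)

Local Notation gt := (affine B).
Implicit Types (X Y : gt).

Lemma tpowD x y k : tpow B (x + y) k = tpow B x k + tpow B y k.
Proof. by congr (_, _, _); rewrite /= ?addr0 // monalgUD. Qed.

Lemma tpowZ c x k : tpow B (c *: x) k = c *: tpow B x k.
Proof. by congr (_, _, _); rewrite /= ?scaler0 // loopZU. Qed.

Lemma tpowN x k : tpow B (- x) k = - tpow B x k.
Proof. by rewrite -!scaleN1r tpowZ. Qed.

(* Twice the projection of x[k] onto the fixed points of the involution. *)
Definition ktpow k x : gt := tpow B x k + tpow B (om x) (- k).

Lemma ktpow_linear k : linear (ktpow k).
Proof.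
by move=> c x y; rewrite /ktpow linearP !tpowD !tpowZ scalerDr addrACA.
Qed.

HB.instance Definition _ k :=
  GRing.isLinear.Build K g gt *:%R (ktpow k) (ktpow_linear k).

Lemma ktpowZ c x k : ktpow k (c *: x) = c *: ktpow k x.
Proof. exact: linearZZ. Qed.

Lemma ktpowN x k : ktpow k (- x) = - ktpow k x.
Proof. exact: linearN. Qed.

Lemma ktpow_omega x k : ktpow k (om x) = ktpow (- k) x.
Proof. by rewrite /ktpow omega_invol opprK addrC. Qed.

Lemma bracket_ktpow x y k m : [lie ktpow k x, ktpow m y]
  = ktpow (k + m) [lie x, y] + ktpow (k - m) [lie x, om y].
Proof.
rewrite /ktpow bracketDl !bracketDr !bracket_tpow !omega_bracket omega_invol.
rewrite !opprK !opprD opprK form_omega.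
have -> : B (om x) y = B x (om y) by rewrite -form_omega omega_invol.
rewrite !eqr_oppLR !opprK.
set c := affine_c _; set p := _ *+ _; set q := _ *+ _.
(* Of the four central coefficients, [p] comes from [x[k]] and [y[m]], and [q] from [x[k]] and [om
   y[-m]]. Applying the involution to both factors keeps the form value and negates the degree, so
   the other two are [- p] and [- q]. *)
have -> : ((- k)%:~R * B x (om y)) *+ (k == m) = - q.
  by rewrite /q rmorphN mulNr mulNrn.
have -> : ((- k)%:~R * B x y) *+ (k == - m) = - p.
  by rewrite /p rmorphN mulNr mulNrn.
rewrite !scaleNr; set P := p *: c; set Q := q *: c.
rewrite [LHS]addrACA (addrACA _ P) (addrACA _ Q) [LHS]addrACA.
by rewrite -(opprB Q P) addNr addr0 [LHS]addrACA (addrC (tpow B _ (- k + m)))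
  [LHS]addrACA.
Qed.

(** * The basis elements as vectors Y(x, k) *)

Lemma y_pos_realE a k : a \in Phi D -> y_pos_real Ch (a, k) = ktpow k (e a).
Proof. by move=> aP; rewrite /y_pos_real /ktpow omega_eroot //= tpowN. Qed.

Lemma root_pos_or_neg a : a \in Phi D -> is_pos_root a \/ is_pos_root (- a).
Proof.
move=> aP; rewrite /is_pos_root oppr_Phi // aP /=.
have [_ _ /(_ a aP)[aN|aN]] := simple_rootP D.
  by left; apply/asboolP.
by right; apply/asboolP.
Qed.

Lemma pos_real_or_neg a k : a \in Phi D ->
  is_pos_real ((a, k) : aweight D) || is_pos_real ((- a, - k) : aweight D).
Proof.
move=> aP; rewrite /is_pos_real /= aP oppr_Phi //= oppr_gt0 oppr_eq0.
by case: (ltrgtP 0 k) => //= _; case: (root_pos_or_neg aP) => ->; rewrite ?orbT.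
Qed.

(** The sign convention at negative roots agrees with Y(e_{-a}, -k) = -Y(omega e_a, -k) = -Y(e_a,
    k), so later computations need no case distinction on positivity. *)
Lemma y_realE a k : a \in Phi D -> y_real Ch (a, k) = ktpow k (e a).
Proof.
move=> aP; rewrite /y_real; case: ifPn => [_|Np]; first exact: y_pos_realE.
have -> : - ((a, k) : aweight D) = (- a, - k) by [].
have := pos_real_or_neg k aP; rewrite (negbTE Np) /= => ->.
rewrite y_pos_realE ?oppr_Phi // -ktpow_omega omega_eroot ?oppr_Phi //.
by rewrite opprK ktpowN opprK.
Qed.

Lemma y_pos_imagE i k : y_pos_imag D i k = ktpow k (hs i).
Proof. by rewrite /y_pos_imag /ktpow omega_cartan tpowN. Qed.

Lemma ktpow_cartanN u k : ktpow (- k) (vsval u) = - ktpow k (vsval u).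
Proof. by rewrite -ktpow_omega omega_cartan ktpowN. Qed.

Lemma y_imagE i k : y_imag D i k = ktpow k (hs i).
Proof.
rewrite /y_imag !y_pos_imagE oppr_gt0 ktpow_cartanN opprK.
(* For [k = 0], Y(h_i, 0) equals its own opposite and so vanishes, in accordance with the convention
   y_0 = 0. *)
case: (ltrgtP 0 k) => // <-; apply/esym/addrr_eq0.
by rewrite -(addNr (ktpow 0 (hs i))) -[in RHS]ktpow_cartanN oppr0.
Qed.

(** * The structure constants *)

Lemma ktpow_coroot a k : a \in Phi D ->
  ktpow k (vsval (hroot a)) = \sum_(i < r) y_imag D i k *~ kcoef Ch a i.
Proof.
move=> aP; rewrite (kcoefP Ch aP) linear_sum (linear_sum (ktpow k)).
by apply: eq_bigr => i _; rewrite y_imagE !raddfMz.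
Qed.

Lemma bracket_y_real_same a l m : a \in Phi D ->
  [lie y_real Ch (a, l), y_real Ch (a, m)]
    = \sum_(i < r) y_imag D i (m - l) *~ kcoef Ch a i.
Proof.
move=> aP; rewrite !y_realE // bracket_ktpow bracketxx omega_eroot //.
rewrite linear0 add0r -scaleN1r bracketZr bracket_eroot //.
by rewrite scaleN1r ktpowN -ktpow_cartanN opprB ktpow_coroot.
Qed.

Lemma bracket_y_real_opp a l m : a \in Phi D ->
  [lie y_real Ch (a, l), y_real Ch (- a, m)]
    = \sum_(i < r) y_imag D i (m + l) *~ kcoef Ch a i.
Proof.
move=> aP; have aNP := oppr_Phi aP; rewrite !y_realE // bracket_ktpow.
rewrite omega_eroot // opprK bracket_eroot // -scaleN1r bracketZr bracketxx.
by rewrite scaler0 linear0 addr0 addrC ktpow_coroot.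
Qed.

(** When [a + b] is not a root, the coefficient [kappa] is 0, so the value of [y_real] there does
    not matter. The case [a + b = 0] is excluded because the bracket is then a coroot. *)
Lemma ktpow_kappa a b k : a \in Phi D -> b \in Phi D -> a + b != 0 ->
  ktpow k [lie e a, e b] = y_real Ch (a + b, k) *~ kappa Ch a b.
Proof.
move=> aP bP ab0; rewrite bracket_eroots // (raddfMz (ktpow k)).
have [abP|abP] := boolP (a + b \in Phi D); first by rewrite y_realE.
by rewrite (kappa0 Ch aP bP abP) !mulr0z.
Qed.

Lemma bracket_y_real a b l m :
    a \in Phi D -> b \in Phi D -> a <> b -> a <> - b ->
  [lie y_real Ch (a, l), y_real Ch (b, m)]
    = y_real Ch (a + b, l + m) *~ kappa Ch a b
      - y_real Ch (a - b, l - m) *~ kappa Ch a (- b).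
Proof.
move=> aP bP /eqP aNb /eqP aNNb.
rewrite (y_realE _ aP) (y_realE _ bP) bracket_ktpow.
rewrite omega_eroot // -scaleN1r bracketZr scaleN1r ktpowN.
by rewrite !ktpow_kappa ?oppr_Phi ?subr_eq0 ?addr_eq0.
Qed.

Lemma bracket_y_imag_real a l m i : a \in Phi D ->
  [lie y_imag D i l, y_real Ch (a, m)]
    = (a (hsimple D i) : K) *: y_real Ch (a, l + m)
      - (a (hsimple D i) : K) *: y_real Ch (a, m - l).
Proof.
move=> aP; have aNP := oppr_Phi aP; rewrite y_imagE !y_realE // bracket_ktpow.
rewrite (eroot_root Ch aP) (omega_root_space (eroot_root Ch aP)).
by rewrite !ktpowZ ktpow_omega opprB opp_lfunE scaleNr.
Qed.

Lemma bracket_y_imag l m i j : [lie y_imag D i l, y_imag D j m] = 0.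
Proof.
rewrite !y_imagE bracket_ktpow omega_cartan -linearN.
by rewrite !bracket_cartan !linear0 addr0.
Qed.

(** * Fixed points of the affine involution in terms of loop coefficients *)

Definition loop_part X : loop g := X.1.1.

Lemma loop_partD X Y : loop_part (X + Y) = loop_part X + loop_part Y.
Proof. by []. Qed.

Lemma coef_affine_omega X k :
  (loop_part (affine_omega Ch X))@_k = om (loop_part X)@_(- k).
Proof.
case: X => [[u c] d] /=; rewrite /loop_part /=.
pose F (u : loop g) : loop g := \sum_(k <- msupp u) << om u@_k *g - k >>.
pose f (n : int) x : loop g := << om x *g - n >>.
have f0 n : f n 0 = 0 by rewrite /f linear0 monalgU0.
have fD n : {morph f n : x y / x + y}.
  by move=> x y; rewrite /f linearD monalgUD.
rewrite -/(F u); elim/loop_ind: u => [x n|u v IHu IHv].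
  rewrite [F _](sum_msuppU x (f0 n)) /f !mcoeffU raddfMn.
  by rewrite eqr_oppLR.
have -> : F (u + v) = F u + F v by apply: (sum_msuppD u v fD).
by rewrite !mcoeffD IHu IHv linearD.
Qed.

(** The involution negates the coordinates at [c] and [d], so they vanish on fixed elements; what
    remains is a condition on the loop coefficients. *)
Lemma in_ktP X : in_kt Ch X <->
  [/\ X.1.2 = 0, X.2 = 0
    & forall k, om (loop_part X)@_(- k) = (loop_part X)@_k].
Proof.
have oppr_fix (c : K) : - c = c -> c = 0.
  by move=> cN; apply: (@addrr_eq0 K^o); rewrite -{1}cN addNr.
split=> [fX|].
  split; try by apply: oppr_fix; rewrite -{2}fX; case: X {fX} => [[u c] d].
  by move=> k; rewrite -coef_affine_omega fX.
case: X => [[u c] d] /= [-> -> fu]; rewrite /in_kt /=.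
congr (_, _, _); rewrite ?oppr0 //; apply/malgP => k.
have := coef_affine_omega (u, 0, 0) k; rewrite /loop_part /= => ->.
exact: fu.
Qed.

Lemma coef_scale c X k : (loop_part (c *: X))@_k = c *: (loop_part X)@_k.
Proof. exact: loop_scaleE. Qed.

Lemma in_kt_comb X Y n : in_kt Ch X -> in_kt Ch Y -> in_kt Ch (X *~ n + Y).
Proof.
have E : X *~ n = (n%:~R : K) *: X by rewrite scaler_int.
move=> /in_ktP[X1 X2 fX] /in_ktP[Y1 Y2 fY]; rewrite E; apply/in_ktP.
split; rewrite /= ?X1 ?X2 ?Y1 ?Y2 ?scaler0 ?addr0 // => k.
rewrite loop_partD !mcoeffD linearD; congr (_ + _); last exact: fY.
by rewrite !coef_scale linearZ; congr (_ *: _); apply: fX.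
Qed.

Lemma coef_ktpow k x m :
  (loop_part (ktpow k x))@_m = x *+ (k == m) + om x *+ (- k == m).
Proof. by rewrite loop_partD mcoeffD !mcoeffU. Qed.

Lemma ktpow_in_kt k x : in_kt Ch (ktpow k x).
Proof.
apply/in_ktP; split=> [||m]; rewrite /= ?addr0 //.
rewrite !coef_ktpow linearD /= !linearMn /= omega_invol eqr_opp addrC.
by rewrite -eqr_oppLR.
Qed.

(** * The coordinate functionals phi_j and their duality with the y_j *)

Definition ycoef (j : y_index D) X : K :=
  match j with
  | inl c => bcoef chevalley_seq (e (val c).1) (loop_part X)@_(val c).2
  | inr (k, i) => bcoef chevalley_seq (hs i) (loop_part X)@_(val k)
  end.

Lemma ycoef_linear j : scalar (ycoef j).
Proof.
move=> c X Y; case: j => [d|[k i]];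
by rewrite /= loop_partD mcoeffD coef_scale linearP.
Qed.

HB.instance Definition _ j :=
  GRing.isLinear.Build K gt K *%R (ycoef j) (ycoef_linear j).

Local Notation bc := (bcoef chevalley_seq).

Lemma bcoef_hsimple i j : bc (hs i) (hs j) = (i == j)%:R.
Proof.
rewrite (bcoef_mem (chevalley_basis Ch)) ?hsimple_chevalley //.
by rewrite (inj_eq hsimple_inj).
Qed.

(** A common value would commute with the Cartan subalgebra and also be a nonzero vector of weight
    [a != 0]. *)
Lemma hsimple_neq_eroot i a : a \in Phi D -> hs i != e a.
Proof.
move=> aP; have [u au] := lfun_neq0P (root_neq0 aP).
apply: contraNneq au => he; have := eroot_root Ch aP u.
rewrite -he bracket_cartan => /esym/eqP; rewrite scaler_eq0 he.
by rewrite (negbTE (eroot_neq0 aP)) orbF.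
Qed.

Lemma bcoef_hsimple_eroot i a : a \in Phi D -> bc (hs i) (e a) = 0.
Proof.
move=> aP; rewrite (bcoef_mem (chevalley_basis Ch)) ?eroot_chevalley //.
by rewrite (negbTE (hsimple_neq_eroot i aP)).
Qed.

Lemma bcoef_eroot_hsimple i a : a \in Phi D -> bc (e a) (hs i) = 0.
Proof.
move=> aP; rewrite (bcoef_mem (chevalley_basis Ch)) ?hsimple_chevalley //.
by rewrite eq_sym (negbTE (hsimple_neq_eroot i aP)).
Qed.

Lemma eroot_inj : {in Phi D &, injective e}.
Proof.
move=> a b aP bP eab; apply/lfunP => u; apply/eqP; rewrite -subr_eq0.
have := eroot_root Ch bP u; rewrite -eab (eroot_root Ch aP) => /eqP.
by rewrite -subr_eq0 -scalerBl scaler_eq0 (negbTE (eroot_neq0 aP)) orbF.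
Qed.

Lemma bcoef_eroot a b : a \in Phi D -> b \in Phi D ->
  bc (e a) (e b) = (a == b)%:R.
Proof.
move=> aP bP; rewrite (bcoef_mem (chevalley_basis Ch)) ?eroot_chevalley //.
by rewrite (inj_in_eq eroot_inj).
Qed.

(** Up to sign, [om] permutes the Chevalley basis, exchanging [e a] with [e (- a)]. *)
Lemma bcoef_eroot_omega a x : a \in Phi D -> bc (e a) (om x) = - bc (e (- a)) x.
Proof.
move=> aP; have aNP := oppr_Phi aP.
elim/chevalley_ind: x => [|c x y IHx IHy|i|b bP].
- by rewrite !linear0 oppr0.
- by rewrite !linearP /= IHx IHy opprD mulrN.
- by rewrite omega_cartan linearN /= !bcoef_eroot_hsimple.
by rewrite omega_eroot // linearN /= !bcoef_eroot ?oppr_Phi // eqr_oppLR.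
Qed.

Lemma bcoef_hsimple_omega i x : bc (hs i) (om x) = - bc (hs i) x.
Proof.
elim/chevalley_ind: x => [|c x y IHx IHy|j|b bP].
- by rewrite !linear0 oppr0.
- by rewrite !linearP /= IHx IHy opprD mulrN.
- by rewrite omega_cartan linearN.
by rewrite omega_eroot // linearN /= !bcoef_hsimple_eroot ?oppr_Phi.
Qed.

(** Adding expansions of [a] and [- a] with natural coefficients gives a vanishing combination of
    the simple roots. Freeness makes each [n i + m i] zero, hence [n = 0] and [a = 0], which is not
    a root. *)
Lemma pos_root_oppF a : is_pos_root a -> is_pos_root (- a) = false.
Proof.
move=> /andP[aP /asboolP[n an]]; apply/negP => /andP[_ /asboolP[m am]].
have [_ sb _] := simple_rootP D; have sf := basis_free sb.
have s0 : \sum_i simple_root D i *+ (n i + m i) = 0.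
  under eq_bigr do rewrite mulrnDr.
  by rewrite big_split /= -an -am subrr.
have n0 i : n i = 0%N.
  have /freeP sfP : free [tuple simple_root D i | i < r] by [].
  have sum0 : \sum_(i < r) (n i + m i)%:R *:
      [tuple simple_root D i | i < r]`_i = 0.
    rewrite -[RHS]s0; apply: eq_bigr => {}i _.
    by rewrite -tnth_nth tnth_mktuple scaler_nat.
  have /eqP := sfP _ sum0 i.
  by rewrite pnatr_eq0 addn_eq0 => /andP[/eqP].
case/eqP: (root_neq0 aP); rewrite an big1 // => i _; by rewrite n0.
Qed.

Lemma pos_real_oppF a k :
  is_pos_real ((a, k) : aweight D) ->
  is_pos_real ((- a, - k) : aweight D) = false.
Proof.
rewrite /is_pos_real /= oppr_gt0 oppr_eq0 => /andP[_].
case: (ltrgtP 0 k) => //= _; rewrite ?andbF // => /pos_root_oppF ->.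
by rewrite andbF.
Qed.

Lemma ycoef_ktpow_inl (c : {c : aweight D | is_pos_real c}) m x :
  ycoef (inl c) (ktpow m x)
  = bc (e (val c).1) x *+ (m == (val c).2)
    - bc (e (- (val c).1)) x *+ (- m == (val c).2).
Proof.
have cP : (val c).1 \in Phi D by have /andP[] := valP c.
by rewrite /= coef_ktpow linearD !linearMn /= bcoef_eroot_omega // mulNrn.
Qed.

Lemma ycoef_ktpow_inr (k : {k : int | 0 < k}) i m x :
  ycoef (inr (k, i)) (ktpow m x)
  = bc (hs i) x *+ (m == val k) - bc (hs i) x *+ (- m == val k).
Proof.
by rewrite /= coef_ktpow linearD !linearMn /= bcoef_hsimple_omega mulNrn.
Qed.

Lemma ycoef_family j j' : ycoef j (y_family Ch j') = (j == j')%:R.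
Proof.
case: j' => [[[b m] bm]|[[m m0] i']] /=.
  have bP : b \in Phi D by case/andP: (bm).
  rewrite y_realE //; case: j => [[[a k] ak]|[[k k0] i]].
    have aP : a \in Phi D by case/andP: (ak).
    rewrite ycoef_ktpow_inl /= !bcoef_eroot ?oppr_Phi // -!mulrnA !mulnb.
    (* The second term of phi_j could contribute only if the index of the basis element were the
       opposite of [(a, k)], but both are positive. *)
    have -> : (- a == b) && (- m == k) = false.
      apply: contraFF (pos_real_oppF ak) => /andP[/eqP -> /eqP <-].
      by rewrite opprK.
    by rewrite subr0 (eq_sym m k).
  by rewrite ycoef_ktpow_inr /= !bcoef_hsimple_eroot // !mul0rn subr0.
rewrite y_imagE; case: j => [[[a k] ak]|[[k k0] i]].
  have aP : a \in Phi D by case/andP: (ak).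
  by rewrite ycoef_ktpow_inl /= !bcoef_eroot_hsimple ?oppr_Phi // !mul0rn subr0.
rewrite ycoef_ktpow_inr /= bcoef_hsimple -!mulrnA !mulnb.
have -> : (- m == k) = false.
  by apply/eqP => mk; move: k0; rewrite -mk oppr_gt0 ltNge ltW.
by rewrite andbF subr0 andbC (eq_sym m k).
Qed.

Lemma ycoef_sum (c : {malg int[y_index D]}) j :
  ycoef j (\sum_(i <- msupp c) y_family Ch i *~ c@_i) = (c@_j)%:~R.
Proof.
rewrite linear_sum /=.
under eq_bigr do rewrite raddfMz /= ycoef_family.
have [jc|jc] := boolP (j \in msupp c).
  rewrite (bigD1_seq j) ?fset_uniq //= eqxx big1 ?addr0 // => i /negbTE.
  by rewrite eq_sym => ->; rewrite mul0rz.
rewrite mcoeff_outdom // big_seq big1 // => i ic.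
by case: eqP jc ic => [->|_ _ _]; [move/negP|rewrite mul0rz].
Qed.

(** Taking [c] in [{malg int[y_index D]}] records integrality and finite support at once. It
    suffices to treat generators: [c] and [d] have no loop part, while [h_i[k]] and [e_a[k]] have a
    single coordinate equal to 1 if their degree is a positive affine root, and all coordinates zero
    otherwise. *)
Lemma ycoef_integral X : in_gtZ Ch X ->
  exists c : {malg int[y_index D]}, forall j, ycoef j X = (c@_j)%:~R.
Proof.
case=> s sS ->; elim: s sS => [|[n Y] s IH] sS.
  by exists 0 => j; rewrite big_nil mcoeff0 linear0.
have [|c cE] := IH; first by move=> p ps; apply: sS; rewrite inE ps orbT.
suff [d dE] : exists d : {malg int[y_index D]},
    forall j, ycoef j Y = (d@_j)%:~R.
  exists (d *~ n + c) => j; rewrite big_cons linearD /= cE raddfMz /= dE.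
  by rewrite mcoeffD raddfMz /= rmorphD /= -mulrzr -intrM mulrzz.
have /= := sS (n, Y) (mem_head _ _); case=> [->|->|[i [k ->]]|[a [k [aP ->]]]].
- by exists 0 => -[c'|[k i]]; rewrite mcoeff0 /= mcoeff0 linear0.
- by exists 0 => -[c'|[k i]]; rewrite mcoeff0 /= mcoeff0 linear0.
- have [k0|/negP k0] := boolP (0 < k).
    exists << 1 *g (inr (exist _ k k0, i) : y_index D) >>.
    case=> [[[a m] am]|[[m m0] i']];
      rewrite mcoeffU rmorph_nat /= mcoeffU linearMn /=.
      by rewrite bcoef_eroot_hsimple ?mul0rn //; case/andP: (am).
    by rewrite bcoef_hsimple -mulrnA mulnb andbC (eq_sym i').
  exists 0; case=> [[[a m] am]|[[m m0] i']];
    rewrite mcoeff0 /= mcoeffU linearMn /=.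
    by rewrite bcoef_eroot_hsimple ?mul0rn //; case/andP: (am).
  by case: eqP k0 => // ->.
have [ak|/negP ak] := boolP (is_pos_real ((a, k) : aweight D)).
  exists << 1 *g (inl (exist _ (a, k) ak) : y_index D) >>.
  case=> [[[b m] bm]|[[m m0] i']];
      rewrite mcoeffU rmorph_nat /= mcoeffU linearMn /=.
    rewrite bcoef_eroot -?mulrnA ?mulnb 1?(eq_sym b) //.
    by case/andP: (bm).
  by rewrite bcoef_hsimple_eroot ?mul0rn.
exists 0; case=> [[[b m] bm]|[[m m0] i']];
    rewrite mcoeff0 /= mcoeffU linearMn /=.
  rewrite bcoef_eroot // -?mulrnA ?mulnb; last by case/andP: (bm).
  by case: andP ak => // -[/eqP <- /eqP ->].
by rewrite bcoef_hsimple_eroot ?mul0rn.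
Qed.

Lemma ycoef_eq0 X : in_kt Ch X -> (forall j, ycoef j X = 0) -> X = 0.
Proof.
move=> /in_ktP[X1 X2 fX] X0.
suff: loop_part X = 0.
  by move: X1 X2; rewrite /loop_part; case: X {fX X0} => [[u c] d] /= -> -> ->.
apply/malgP => k; rewrite mcoeff0; apply: (bcoef_eq0 (chevalley_basis Ch)).
move=> v /chevalley_seqP[[i ->]|[a aP ->]].
  have X0i m (m0 : 0 < m) := X0 (inr (exist _ m m0, i)).
  case: (ltrgtP 0 k) => [/X0i //|k0|k0].
    rewrite -fX bcoef_hsimple_omega; apply/eqP; rewrite oppr_eq0; apply/eqP.
    by apply: X0i; rewrite oppr_gt0.
  (* No phi_j reads the Cartan coordinates in degree 0; there fixedness makes each coordinate equal
     to its own opposite. *)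
  apply: (@addrr_eq0 K^o); rewrite -{2}fX -k0 oppr0 bcoef_hsimple_omega.
  exact: subrr.
have [ak|ak] := orP (pos_real_or_neg k aP); first exact: (X0 (inl (exist _ (a, k) ak))).
rewrite -fX bcoef_eroot_omega //; apply/eqP; rewrite oppr_eq0; apply/eqP.
exact: (X0 (inl (exist _ (- a, - k) ak))).
Qed.

(** * The basis property *)

Lemma y_family_in_ktZ j : in_ktZ Ch (y_family Ch j).
Proof.
have gtZB X Y : in_gtZ Ch X -> in_gtZ Ch Y -> in_gtZ Ch (X - Y).
  by move=> XZ YZ; rewrite addrC -(mulrN1z Y); apply: zspan_comb.
case: j => [[[a k] ak]|[[k k0] i]] /=.
  have aP : a \in Phi D by case/andP: (ak).
  split; last by rewrite y_realE //; apply: ktpow_in_kt.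
  rewrite /y_real ak; apply: gtZB; apply: zspan_gen; apply: Or44.
    by exists a, k.
  by exists (- a), (- k); rewrite oppr_Phi.
split; last by rewrite y_imagE; apply: ktpow_in_kt.
rewrite /y_imag k0; apply: gtZB; apply: zspan_gen; apply: Or43.
  by exists i, k.
by exists i, (- k).
Qed.

Lemma y_sum_in_ktZ (s : seq (y_index D)) (n : y_index D -> int) :
  in_ktZ Ch (\sum_(j <- s) y_family Ch j *~ n j).
Proof.
elim/big_rec: _ => [|i X _ [XZ Xk]].
  split; first exact: zspan0.
  have z k : (loop_part 0)@_k = 0 by exact: mcoeff0.
  by apply/in_ktP; split=> // k; rewrite !z linear0.
have [yZ yk] := y_family_in_ktZ i.
by split; [apply: zspan_comb|apply: in_kt_comb].
Qed.

Lemma y_family_zbasis : zbasis (in_ktZ Ch) (y_family Ch).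
Proof.
move=> X; split=> [[XZ Xk]|[c [-> _]]]; last exact: y_sum_in_ktZ.
(* The coefficients must be the values phi_j(X), by duality. Uniqueness then follows since the
   integers embed in [K]. *)
have [c cE] := ycoef_integral XZ; exists c; split=> [|c' Xc']; last first.
  apply/malgP => j; apply: (@intr_inj K).
  by rewrite -cE Xc' ycoef_sum.
(* For existence, the difference of [X] and the combination with coefficients [c] is fixed and
   killed by every phi_j. *)
have [_ Sk] := y_sum_in_ktZ (msupp c) (fun j => c@_j).
apply/esym/eqP; rewrite -subr_eq0; apply/eqP; apply: ycoef_eq0 => [|j].
  by rewrite -(mulr1z (\sum_(i <- _) _)) -(mulrN1z X) addrC; apply: in_kt_comb.
by rewrite linearB /= ycoef_sum cE subrr.
Qed.

End ChevalleyDatum.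

Theorem proposition3p4 (R : realType) (g : finLieAlgType R[i]) (r : nat)
    (D : rootDatum g r) (Ch : chevalleyDatum D) (g_simple : is_simple g) :
  [/\ zbasis (in_ktZ Ch) (y_family Ch),
      forall (a : hdual (cartan D)) (l m : int), a \in Phi D ->
        [lie y_real Ch (a, l), y_real Ch (a, m)]
          = \sum_(i < r) y_imag D i (m - l) *~ kcoef Ch a i
        /\
        [lie y_real Ch (a, l), y_real Ch (- a, m)]
          = \sum_(i < r) y_imag D i (m + l) *~ kcoef Ch a i,
      forall (a b : hdual (cartan D)) (l m : int),
        a \in Phi D -> b \in Phi D -> a <> b -> a <> - b ->
        [lie y_real Ch (a, l), y_real Ch (b, m)]
          = y_real Ch (a + b, l + m) *~ kappa Ch a b
            - y_real Ch (a - b, l - m) *~ kappa Ch a (- b),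
      forall (a : hdual (cartan D)) (l m : int) (i : 'I_r), a \in Phi D ->
        [lie y_imag D i l, y_real Ch (a, m)]
          = (a (hsimple D i) : R[i]) *: y_real Ch (a, l + m)
            - (a (hsimple D i) : R[i]) *: y_real Ch (a, m - l)
    & forall (l m : int) (i j : 'I_r), [lie y_imag D i l, y_imag D j m] = 0].
Proof.
split.
- exact: y_family_zbasis.
- move=> a l m aP.
  by split; [apply: bracket_y_real_same|apply: bracket_y_real_opp].
- move=> a b l m; exact: bracket_y_real.
- move=> a l m i; exact: bracket_y_imag_real.
- move=> l m i j; exact: bracket_y_imag.
Qed.
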